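(* Let $m>0$ and suppose the angle $\theta$ satisfies the Diophantine condition (D.C.-$m$). Then there exists $c>0$ such that $\theta$ satisfies $\mathrm{DPV}(n,R)$ for all sufficiently large $n$ and all $R<\exp(c(\log n)^2)$. That is, for all sufficiently large $n$, $$R_{\mathrm{DPV}}(n,\theta)\ge\exp(c(\log n)^2).$$
   Context: An angle $\theta\in[0,2\pi]$ satisfies (D.C.-$m$) if for all $p\in\mathbb{Z}$ and all sufficiently large $q\in\mathbb{N}$, $|\theta-\frac{2\pi p}{q}|\ge q^{-m}$. Dense polynomial values: $\theta$ satisfies $\mathrm{DPV}(n,R)$ if the set $$\Big\{\log\Big(\sum_{j=0}^D c_je^{ij\theta}\Big)\ \Big|\ D\ge0,\ c_j\in\mathbb{Z},\ \sum_{j=0}^D(1+|c_j|)\le n\Big\}$$ (over those sums that are nonzero) forms a $0.1$-net in $[-\log R,0]\times[0,2\pi]\subset\mathbb{C}$, i.e. every point of this rectangle is within distance $0.1$ of a point of the set. Here $\log w=\log|w|+i\arg w$ with $\arg w\in[0,2\pi)$, and $\mathbb{C}$ is identified with $\mathbb{R}^2$ via real and imaginary parts. Further, $R_{\mathrm{DPV}}(n,\theta):=\sup\{R\in\mathbb{R}\mid\theta\text{ satisfies }\mathrm{DPV}(n,R)\}$. *)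

(* Defs.v *)
From mathcomp Require Import all_boot all_order all_algebra.
From mathcomp Require Import all_classical all_reals all_analysis.
From mathcomp Require Import complex.
From mathcomp Require Import lra.

Set Implicit Arguments.
Unset Strict Implicit.
Unset Printing Implicit Defensive.

Import Order.TTheory GRing.Theory Num.Theory.
Import numFieldNormedType.Exports.

Local Open Scope classical_set_scope.
Local Open Scope ring_scope.
Local Open Scope complex_scope.

(* `p` is quantified after `q`: the threshold on `q` is uniform in `p`. *)
Definition diophantine_angle (R : realType) (m theta : R) : Prop :=
  \forall q \near \oo, forall p : int,
    q%:R `^ (- m) <= `|theta - 2 * pi * p%:~R / q%:R|.

Definition cabs (R : realType) (w : R[i]) : R := Normc.normc w.

Definition expi (R : realType) (a : R) : R[i] := cos a +i* sin a.

(* At w = 0 this is an unspecified angle; see cargP and carg_unique below. *)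
Definition carg (R : realType) (w : R[i]) : R :=
  get [set a : R | 0 <= a < 2 * pi /\ w = (cabs w)%:C * expi a].

Definition clog (R : realType) (w : R[i]) : R[i] := ln (cabs w) +i* carg w.

Definition int_poly_value (R : realType) (theta : R) (D : nat)
    (c : 'I_D.+1 -> int) : R[i] :=
  \sum_(j < D.+1) (c j)%:~R * expi (j%:R * theta).

Definition log_poly_values (R : realType) (theta : R) (n : nat) : set R[i] :=
  [set z | exists (D : nat) (c : 'I_D.+1 -> int),
    [/\ (\sum_(j < D.+1) (1 + `|c j|) <= n)%N,
        int_poly_value theta c != 0 &
        z = clog (int_poly_value theta c)]].

Definition is_net (R : realType) (eps : R) (S E : set R[i]) : Prop :=
  forall z, E z -> exists2 s, S s & cabs (z - s) <= eps.

(* Meaningful for 0 < r only, since ln r = 0 for r <= 0. *)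
Definition DPV (R : realType) (theta : R) (n : nat) (r : R) : Prop :=
  is_net (1 / 10) (log_poly_values theta n)
    [set z | - ln r <= complex.Re z <= 0 /\ 0 <= complex.Im z <= 2 * pi].

Definition R_DPV (R : realType) (n : nat) (theta : R) : \bar R :=
  ereal_sup [set r%:E | r in [set r : R | 0 < r /\ DPV theta n r]].

Lemma cargP (R : realType) (w : R[i]) :
  0 <= carg w < 2 * pi /\ w = (cabs w)%:C * expi (carg w).
Proof.
rewrite /carg; case: xgetP => [a _ []//|/= nex]; exfalso.
have pi0 : 0 < pi :> R by exact: pi_gt0.
have pi2 : pi < 2 * pi :> R by rewrite mulr_natl mulr2n ltrDl.
have [w0|w0] := eqVneq (cabs w) 0.
  apply: (nex 0); split; first by rewrite lexx (lt_trans pi0).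
  by rewrite w0 mul0r; apply: Normc.eq0_normc.
case: w => x y in w0 nex *; set r := cabs _ in w0 nex.
have rE : r = Num.sqrt (x ^+ 2 + y ^+ 2) by [].
have r0 : 0 < r by rewrite lt_neqAle eq_sym w0 rE sqrtr_ge0.
have r2 : r ^+ 2 = x ^+ 2 + y ^+ 2 by rewrite rE sqr_sqrtr// addr_ge0 ?sqr_ge0.
have xr2 : (x / r) ^+ 2 + (y / r) ^+ 2 = 1.
  by rewrite !expr_div_n -mulrDl -r2 divff// expf_neq0.
have xr : -1 <= x / r <= 1.
  by rewrite -ler_norml -(@expr_le1 _ 2)// real_normK ?num_real// -xr2 lerDl sqr_ge0.
have [/andP[a0 api] cosa] := acos_def xr.
have sina : sin (acos (x / r)) = `|y| / r.
  rewrite sin_acos// -xr2 [(x / r) ^+ 2 + _]addrC addrK sqrtr_sqr normrM.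
  by rewrite [X in _ * X]gtr0_norm// invr_gt0.
have polar a : cos a = x / r -> sin a = y / r -> x +i* y = r%:C * expi a.
  move=> ca sa; rewrite /expi ca sa; simpc.
  by rewrite ![r * _]mulrC !divfK.
have [y0|y0] := leP 0 y.
  apply: (nex (acos (x / r))); split; first by rewrite a0 (le_lt_trans api).
  by apply: polar => //; rewrite sina ger0_norm.
have a1 : 0 < acos (x / r).
  rewrite lt_neqAle a0 andbT; apply/eqP => a00; move: sina.
  rewrite -a00 sin0 => /esym/eqP; rewrite mulf_eq0 invr_eq0 (negbTE w0) orbF.
  by rewrite normr_eq0 lt_eqF.
apply: (nex (- acos (x / r) + 2 * pi)); split.
  by rewrite addrC subr_ge0 (le_trans api (ltW pi2))/= ltrBlDr ltrDl.
rewrite mulr_natl; apply: polar; first by rewrite cosD2pi cosN.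
by rewrite sinD2pi sinN sina ltr0_norm// mulNr opprK.
Qed.

Lemma carg_unique (R : realType) (w : R[i]) (a : R) :
  w != 0 -> 0 <= a < 2 * pi -> w = (cabs w)%:C * expi a -> carg w = a.
Proof.
move=> wn0 aI wa; have [bI wb] := cargP w.
have r0 : cabs w != 0 by apply: contra_neq wn0; exact: Normc.eq0_normc.
have eab : expi (carg w) = expi a.
  apply: (@mulfI _ (cabs w)%:C); last by rewrite -wb -wa.
  by rewrite eq_complex/= eqxx andbT.
case: eab; move: (carg w) bI => b bI cab sab.
clear - aI bI cab sab.
wlog ab : a b aI bI cab sab / a < b => [H|].
  by case: (ltgtP a b) => [ab|ba|//]; [exact: H | apply/esym/(H b a)].
exfalso.
pose h := (b - a) / 2.
have hE : b - a = h + h by rewrite /h; lra.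
have sh0 : 0 < sin h.
  apply: sin_gt0_pi; move: aI bI => /andP[? ?] /andP[? ?].
  by apply/andP; split; rewrite /h; lra.
have : cos (b - a) = 1 by rewrite cosB cab sab -!expr2 cos2Dsin2.
have : 0 < sin h ^+ 2 by rewrite exprn_gt0.
by rewrite hE cosD -!expr2 cos2sin2; lra.
Qed.

(* Main.v *)
Require Import Defs.
From mathcomp Require Import all_boot all_order all_algebra.
From mathcomp Require Import all_classical all_reals all_analysis.
From mathcomp Require Import complex.
From mathcomp Require Import zify ring lra.

(** With [X = expi (q * theta)], the values used are [a X^t (X - 1)^k] for
    naturals [a], [t], [k]. Dirichlet's theorem gives a polynomially (in [n])
    bounded [q] for which [X - 1] is polynomially small, and the Diophantine
    condition bounds [X - 1] below by a negative power of [n]. Hence [k] of order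
    [log n] powers already reach size [exp (- c (log n)^2)] at cost [2^k]; the gap
    between two consecutive powers is bridged by an [a] polynomial in [n], and
    the argument is tuned by the small rotation [X^t]. *)

Set Implicit Arguments.
Unset Strict Implicit.
Unset Printing Implicit Defensive.

Import Order.TTheory GRing.Theory Num.Theory.
Import numFieldNormedType.Exports.

Local Open Scope classical_set_scope.
Local Open Scope ring_scope.
Local Open Scope complex_scope.

(** * Unit complex numbers and the modulus *)

Lemma expi0 (R : realType) : expi (0 : R) = 1.
Proof. by rewrite /expi cos0 sin0. Qed.

Lemma expiD (R : realType) (a b : R) : expi (a + b) = expi a * expi b.
Proof. by rewrite /expi cosD sinD; simpc; rewrite [X in _ +i* X]addrC. Qed.

Lemma expi_natmul (R : realType) (n : nat) (a : R) : expi (n%:R * a) = expi a ^+ n.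
Proof.
by elim: n => [|n IH]; rewrite ?mul0r ?expi0// -natr1 mulrDl mul1r expiD IH exprSr.
Qed.

Lemma expi_intmul_2pi (R : realType) (p : int) : expi (2 * pi * p%:~R : R) = 1.
Proof.
have e1 : expi (2 * pi : R) = 1.
  by rewrite mulr_natl /expi cos2pi sin2pi.
have en n : expi (2 * pi * n%:R : R) = 1 by rewrite mulrC expi_natmul e1 expr1n.
case: p => n; first exact: en.
rewrite NegzE mulrNz mulrN -[LHS]mul1r -[X in X * _](en n.+1) -expiD.
by rewrite subrr expi0.
Qed.

Lemma cabs_expi (R : realType) (a : R) : cabs (expi a) = 1.
Proof. by rewrite /cabs /expi /= cos2Dsin2 sqrtr1. Qed.

Lemma cabsM (R : realType) (v w : R[i]) : cabs (v * w) = cabs v * cabs w.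
Proof. exact: Normc.normcM. Qed.

Lemma cabsX (R : realType) (w : R[i]) (k : nat) : cabs (w ^+ k) = cabs w ^+ k.
Proof.
by elim: k => [|k IH]; rewrite ?expr0 ?exprS ?cabsM ?IH//; exact: Normc.normc1.
Qed.

Lemma cabs_real (R : realType) (x : R) : 0 <= x -> cabs x%:C = x.
Proof. by move=> x0; rewrite /cabs /= expr0n addr0 sqrtr_sqr ger0_norm. Qed.

Lemma cabs_le_ReIm (R : realType) (w : R[i]) :
  cabs w <= `|complex.Re w| + `|complex.Im w|.
Proof.
case: w => x y; rewrite /cabs /=.
rewrite -[leRHS]ger0_norm ?addr_ge0// -sqrtr_sqr ler_wsqrtr//.
rewrite -[x ^+ 2]real_normK ?num_real// -[y ^+ 2]real_normK ?num_real//.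
by rewrite sqrrD lerD2r lerDl mulrn_wge0 ?mulr_ge0.
Qed.

(** * Sine estimates and chord lengths *)

Lemma norm_sin_le (R : realType) (x : R) : `|sin x| <= `|x|.
Proof.
wlog x0 : x / 0 <= x.
  move=> H; have [|/ltW x0] := leP 0 x; first exact: H.
  by rewrite -normrN -[`|x|]normrN -sinN; apply: H; rewrite oppr_ge0.
have [c _] := @MVT_segment R sin cos 0 x x0 (fun y _ => is_derive_sin y)
  (continuous_subspaceT (@continuous_sin R)).
rewrite sin0 !subr0 => ->; rewrite normrM ler_piMl//.
by rewrite ler_norml cos_geN1 cos_le1.
Qed.

Lemma cos_double_angle (R : realType) (x : R) : cos x = 1 - 2 * sin (x / 2) ^+ 2.
Proof.
rewrite {1}(splitr x) cosD -!expr2 cos2sin2; lra.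
Qed.

Lemma norm_sin_ge (R : realType) (x : R) : `|x| <= 1 -> `|x| / 2 <= `|sin x|.
Proof.
wlog x0 : x / 0 <= x.
  move=> H; have [|/ltW x0] := leP 0 x; first exact: H.
  by rewrite -normrN -[`|sin x|]normrN -sinN; apply: H; rewrite oppr_ge0.
move=> x1.
have [c /[!in_itv]/= /andP[c0 cx]] := @MVT_segment R sin cos 0 x x0
  (fun y _ => is_derive_sin y) (continuous_subspaceT (@continuous_sin R)).
rewrite sin0 !subr0 => ->; rewrite normrM mulrC ler_wpM2r//.
(* The slope satisfies [cos c >= 1 - c^2 / 2 >= 1 / 2], because [c] lies between 0 and 1. *)
rewrite (le_trans _ (ler_norm _))// cos_double_angle.
have := norm_sin_le (c / 2); rewrite -(ler_pXn2r (_ : 0 < 2)%N) ?nnegrE//.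
rewrite !real_normK ?num_real// => h.
have : c ^+ 2 <= 1 by rewrite expr_le1// (le_trans cx)// -[x]ger0_norm.
move: h; rewrite expr_div_n; lra.
Qed.

Lemma cabs_chord (R : realType) (d : R) : cabs (expi d - 1) = 2 * `|sin (d / 2)|.
Proof.
rewrite /cabs /= -[RHS]ger0_norm ?mulr_ge0// -sqrtr_sqr; congr Num.sqrt.
rewrite exprMn real_normK ?num_real// subr0 sin2cos2 cos_double_angle.
by ring.
Qed.

Lemma cabs_chord_le (R : realType) (d : R) : cabs (expi d - 1) <= `|d|.
Proof.
rewrite cabs_chord (le_trans (ler_wpM2l _ (norm_sin_le _)))//.
by rewrite normrM [`|2^-1|]ger0_norm ?invr_ge0//; lra.
Qed.

Lemma cabs_chord_ge (R : realType) (d : R) :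
  `|d| <= 1 -> `|d| / 2 <= cabs (expi d - 1).
Proof.
move=> d1; rewrite cabs_chord.
have E : `|d / 2| = `|d| / 2 by rewrite normrM [`|2^-1|]ger0_norm ?invr_ge0.
have := @norm_sin_ge R (d / 2); rewrite E; lra.
Qed.

(** * Dirichlet approximation *)

(* Among the [N.+1] fractional parts of [i * x], two share a box of width [1 / N]. *)
Lemma dirichlet_approximation (R : realType) (x : R) (N : nat) :
  (0 < N)%N -> exists q : nat, exists p : int,
    [/\ (0 < q <= N)%N & `|q%:R * x - p%:~R| <= N%:R^-1].
Proof.
case: N => // N _.
pose fl (i : nat) : int := Num.floor (i%:R * x : R).
pose y (i : nat) : R := i%:R * x - (fl i)%:~R.
have y01 i : 0 <= y i < 1.
  by have := floor_itv (i%:R * x : R); rewrite intrD /y /fl; lra.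
pose box (i : nat) := Num.truncn (N.+1%:R * y i).
have box_itv i : (box i)%:R <= N.+1%:R * y i < (box i)%:R + 1.
  by rewrite natr1; apply: truncn_itv; rewrite mulr_ge0//; case/andP: (y01 i).
have boxN i : (box i < N.+1)%N.
  rewrite truncn_lt_nat ?mulr_ge0//; last by case/andP: (y01 i).
  by rewrite gtr_pMr// ; case/andP: (y01 i).
pose f (i : 'I_N.+2) : 'I_N.+1 := Ordinal (boxN i).
have /injectivePn[i [j nij fij]] : ~~ injectiveb f.
  by apply/injectiveP => /inj_leq; rewrite ltnn.
have {f fij} : box i = box j by case: fij.
wlog ij : i j nij / (i < j)%N.
  move=> H bij; have := nij; rewrite -val_eqE neq_ltn => /orP[|]; first by move/H; exact.
  by move/H; apply => //; rewrite eq_sym.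
move=> bij; exists (j - i)%N, (fl j - fl i)%R; split.
  by rewrite subn_gt0 ij (leq_trans (leq_subr _ _))// -ltnS.
have -> : (j - i)%:R * x - (fl j - fl i)%:~R = y j - y i.
  by rewrite natrB ?(ltnW ij)// intrB /y; ring.
rewrite -[leRHS]mul1r ler_pdivlMr// mulrC -[X in X * _]ger0_norm// -normrM.
have := box_itv i; have := box_itv j; rewrite bij (mulrBr _ (y j)) ler_norml.
by move: (N.+1%:R * y i) (N.+1%:R * y j) => u v; lra.
Qed.

(** * Integer polynomials and the size of their coefficients *)

(** The [l1] norm seen through a fixed window of [D] coefficients. This spares degree bookkeeping: a
    shift can only push coefficients out of the window. *)
Definition coef_norm (D : nat) (P : {poly int}) : nat := (\sum_(j < D) `|(P`_j)%R|)%N.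

Lemma coef_norm_mulX (D : nat) (P : {poly int}) :
  (coef_norm D (P * 'X) <= coef_norm D P)%N.
Proof.
case: D => [|D]; first by rewrite /coef_norm !big_ord0.
rewrite /coef_norm big_ord_recl coefMX/= add0n [leqRHS]big_ord_recr/=.
rewrite (leq_trans _ (leq_addr _ _))//.
by apply: leq_sum => i _; rewrite coefMX.
Qed.

(** Multiplication by [X^q] is a shift, so the triangle inequality costs a factor 2, whatever [q]
    is. *)
Lemma coef_norm_mulXnsub1 (D q : nat) (P : {poly int}) :
  (coef_norm D (P * ('X^q - 1)) <= 2 * coef_norm D P)%N.
Proof.
have mulXn : (coef_norm D (P * 'X^q) <= coef_norm D P)%N.
  elim: q => [|q IH]; first by rewrite expr0 mulr1.
  by rewrite exprSr mulrA (leq_trans (coef_norm_mulX _ _)).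
rewrite mul2n -addnn (leq_trans _ (leq_add mulXn (leqnn _)))//.
rewrite /coef_norm -big_split/=; apply: leq_sum => i _.
by rewrite mulrBr mulr1 coefB (leq_trans (leqD_dist _ 0 _))// subr0 sub0r abszN.
Qed.

Lemma int_poly_valueE (R : realType) (theta : R) (D : nat) (P : {poly int}) :
  (size P <= D.+1)%N ->
  int_poly_value theta (fun j : 'I_D.+1 => P`_j)
    = (map_poly (fun z : int => z%:~R) P).[expi theta].
Proof.
move=> sP; rewrite (@horner_coef_wide _ D.+1); last first.
  by rewrite (leq_trans (size_poly _ _)).
by apply: eq_bigr => j _; rewrite coef_map/= expi_natmul.
Qed.

(** Each factor [X^q - 1] at most doubles the [l1] norm, hence [a * 2 ^ k]; the other summand counts
    one for each degree up to [q * (t + k)]. *)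
Lemma int_poly_value_construct (R : realType) (theta : R) (q t k a : nat) :
  exists c : 'I_(q * (t + k)).+1 -> int,
    (\sum_j (1 + `|c j|) <= (q * (t + k)).+1 + a * 2 ^ k)%N /\
    int_poly_value theta c =
      a%:R * expi theta ^+ (q * t) * (expi theta ^+ q - 1) ^+ k.
Proof.
pose P : {poly int} := a%:R%:P * 'X^(q * t) * ('X^q - 1) ^+ k.
pose D := (q * (t + k))%N.
exists (fun j => P`_j); split.
  rewrite big_split/= sum1_card card_ord leq_add2l /P.
  rewrite -[leqLHS]/(coef_norm D.+1 P) /P.
  (* The degree depends on [k], so the window is made arbitrary before the induction. *)
  move: D.+1 => {P D} D; elim: k => [|k IH].
    rewrite expr0 mulr1 muln1 /coef_norm.
    have [qtD|qtD] := ltnP (q * t) D; last first.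
      rewrite big1// => i _; rewrite coefCM coefXn.
      by rewrite ltn_eqF ?mulr0// (leq_trans (ltn_ord i)).
    rewrite (bigD1 (Ordinal qtD))//= coefCM coefXn eqxx mulr1 big1 ?addn0.
      by rewrite natz.
    by move=> i; rewrite -val_eqE/= coefCM coefXn => /negPf ->; rewrite mulr0.
  rewrite exprSr mulrA (leq_trans (coef_norm_mulXnsub1 _ _ _))//.
  by rewrite expnS mulnCA leq_mul2l.
rewrite int_poly_valueE.
  rewrite /P !rmorphM/= !rmorphXn/= map_polyC/= map_polyX rmorphB/= map_polyXn rmorph1.
  by rewrite !hornerE rmorph_nat.
rewrite /P (leq_trans (size_polyMleq _ _))//.
have sXq : (size ('X^q - 1 : {poly int})%R <= q.+1)%N.
  by rewrite (leq_trans (size_polyD _ _))// size_polyXn size_polyN size_poly1 geq_max leqnn.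
have sk : (size (('X^q - 1 : {poly int}) ^+ k)%R <= (q * k).+1)%N.
  rewrite (leq_trans (size_poly_exp_leq _ _))// ltnS.
  by rewrite leq_mul// -subn1 leq_subLR add1n.
have st : (size (a%:R%:P * 'X^(q * t) : {poly int})%R <= (q * t).+1)%N.
  by rewrite mul_polyC (leq_trans (size_scale_leq _ _))// size_polyXn.
rewrite -ltnS mulnDr -addSn -addnS.
move: st sk; move: (size _) (size _) => u v; lia.
Qed.

(** * Reaching a prescribed argument and modulus *)

Lemma reduce_mod_2pi (R : realType) (x : R) :
  exists p : int, 0 <= x - 2 * pi * p%:~R < 2 * pi.
Proof.
have pi0 := pi_gt0 R; have pi20 : 0 < 2 * pi :> R by rewrite mulr_gt0.
exists (Num.floor (x / (2 * pi))).
have := floor_itv (x / (2 * pi)); rewrite intrD ler_pdivlMr// ltr_pdivrMr//.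
by move: (2 * pi) => c; lra.
Qed.

(** Steps of length [|d|] cannot jump over an arc of that length, and one turn takes about
    [2 pi / |d|] of them. The error [e] is one-sided so that [b + e] can later be kept inside
    [[0, 2 pi)]. *)
Lemma rotation_hits_arc (R : realType) (d b beta : R) : 0 < `|d| ->
  exists t : nat, exists p : int, exists e : R,
    [/\ beta + t%:R * d = b + e + 2 * pi * p%:~R, 0 <= e <= `|d| &
        t%:R <= 2 * pi / `|d| + 1].
Proof.
move=> d0; have [dpos|dneg|d00] := ltgtP d 0; last by rewrite d00 normr0 ltxx in d0.
(* Here [d < 0], despite the name [dpos]: moving clockwise, stop at the last point before [b] is
   passed. *)
- have [p] := reduce_mod_2pi (beta - b); set y := _ - _ - _ => /andP[y0 y2].
  have td := truncn_itv (divr_ge0 y0 (ltW d0)).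
  exists (Num.truncn (y / `|d|)), p, (y - (Num.truncn (y / `|d|))%:R * `|d|).
  have ym : y / `|d| <= 2 * pi / `|d| by rewrite ler_pM2r ?invr_gt0 ?ltW.
  move: td; rewrite ler_pdivlMr// ltr_pdivrMr// -natr1 => td.
  split; [by rewrite /y ltr0_norm//; ring|lra|].
  move: td; rewrite -ler_pdivlMr//; lra.
(* Here [d > 0]: stop at the first point strictly past [b], whence the [.+1] in the step count. *)
- have [p] := reduce_mod_2pi (b - beta); set y := _ - _ - _ => /andP[y0 y2].
  have td := truncn_itv (divr_ge0 y0 (ltW d0)).
  exists (Num.truncn (y / `|d|)).+1, (- p), ((Num.truncn (y / `|d|)).+1%:R * `|d| - y).
  have ym : y / `|d| <= 2 * pi / `|d| by rewrite ler_pM2r ?invr_gt0 ?ltW.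
  move: td; rewrite ler_pdivlMr// ltr_pdivrMr// -natr1 => td.
  split; [by rewrite mulrNz /y gtr0_norm//; ring|lra|].
  move: td; rewrite -ler_pdivlMr//; lra.
Qed.

Lemma least_small_power (R : realType) (e x : R) : 0 < e <= 1 / 2 -> 0 < x < 1 ->
  exists k : nat, e ^+ k.+1 <= x < e ^+ k.
Proof.
move=> /andP[e0 e2] /andP[x0 x1].
have exk : exists k, e ^+ k <= x.
  (* With [n > 1 / x], one has [e ^ n <= 1 / 2 ^ n <= 1 / n < x]. *)
  exists (Num.truncn x^-1).+1; set n := _.+1.
  have nx : x^-1 < n%:R by exact: truncnS_gt.
  rewrite (@le_trans _ _ ((1 / 2) ^+ n))//; first by apply: lerXn2r; rewrite ?nnegrE; lra.
  rewrite expr_div_n expr1n -[leRHS]invrK div1r lef_pV2 ?posrE ?invr_gt0 ?exprn_gt0//.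
  by rewrite (le_trans (ltW nx))// -natrX ler_nat ltnW// ltn_expl.
have [[|k] ek min] := ex_minnP exk; first by move: ek; rewrite expr0 leNgt x1.
exists k; rewrite ek/= ltNge; apply/negP => /min; by rewrite ltnn.
Qed.

(** A power of [X - 1] brings the modulus below the target, the integer [a] scales it back up to a
    ratio near 1, and [X^t] turns the argument. The last inequality, from minimality of the power,
    later bounds [k]. *)
Lemma log_value_approx (R : realType) (theta d : R) (q : nat) (p : int) (z : R[i]) :
  q%:R * theta = d + 2 * pi * p%:~R -> 0 < `|d| < 1 / 20 ->
  complex.Re z <= 0 -> 0 <= complex.Im z <= 2 * pi ->
  exists k t a : nat,
    let w := a%:R * expi theta ^+ (q * t) * (expi theta ^+ q - 1) ^+ k.+1 in
    [/\ w != 0, cabs (z - clog w) <= 1 / 10,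
        t%:R <= 9 / `|d|, a%:R <= 80 / `|d| & expR (complex.Re z) <= 40 * `|d| ^+ k].
Proof.
move=> qth /andP[d0 d1] rez /andP[imz0 imz2].
have Xq : expi theta ^+ q = expi d.
  by rewrite -expi_natmul qth expiD expi_intmul_2pi mulr1.
have d2 : `|d| <= 1 by lra.
have := cabs_chord_ge d2; have := cabs_chord_le d.
set eps := expi d - 1; set e0 := cabs eps => e0d de0.
have e0_gt0 : 0 < e0 by lra.
set rho := expR (complex.Re z).
have rho0 : 0 < rho by exact: expR_gt0.
have rho1 : rho <= 1 by rewrite expR_le1.
(* The margin 40 gives [x >= 40] below, so rounding [x] down to the integer [a >= 39] moves the
   logarithm by at most [1 / 39]. *)
have [||k] := @least_small_power _ e0 (rho / 40); [lra|lra|].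
move=> /andP[ek1 ek].
have ek0 : 0 < e0 ^+ k.+1 by exact: exprn_gt0.
pose x := rho / e0 ^+ k.+1.
have x40 : 40 <= x by rewrite ler_pdivlMr//; lra.
have xd : x <= 80 / `|d|.
  rewrite /x exprS ler_pdivrMr ?mulr_gt0 ?exprn_gt0// mulrA.
  apply: (@le_trans _ _ (40 * e0 ^+ k)); first lra.
  rewrite ler_pM2r ?exprn_gt0// mulrAC ler_pdivlMr//; lra.
have /andP[ax xa] : (Num.truncn x)%:R <= x < (Num.truncn x).+1%:R.
  by apply: truncn_itv; lra.
set a := Num.truncn x in ax xa; rewrite -natr1 in xa.
have a39 : 39 <= a%:R :> R by lra.
have a0 : 0 < a%:R :> R by lra.
(* The target argument may be [2 pi], a value [carg] never takes. Since [e < 1 / 20], the cap keeps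
   [b + e] below [2 pi], so no wrap-around occurs. *)
pose b := Num.min (complex.Im z) (2 * pi - 1 / 20).
have pi2 := @pi_ge2 R.
have [bz1 bz2 b0 bpi] : [/\ b <= complex.Im z, complex.Im z <= b + 1 / 20, 0 <= b & b <= 2 * pi - 1 / 20].
  by rewrite /b minElt; case: ltP => H; split; lra.
have [epsI epsE] := cargP eps.
have [t [p' [e [te e_itv td]]]] := rotation_hits_arc b (k.+1%:R * carg eps) d0.
exists k, t, a => w.
have wE : w = (a%:R * e0 ^+ k.+1)%:C * expi (b + e).
  have -> : expi (b + e) = expi (k.+1%:R * carg eps + t%:R * d).
    by rewrite te [RHS]expiD expi_intmul_2pi mulr1.
  rewrite expiD !expi_natmul /w exprM Xq -/eps {1}epsE exprMn -/e0.
  by rewrite rmorphM/= rmorph_nat rmorphXn/=; ring.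
have m0 : 0 < a%:R * e0 ^+ k.+1 by rewrite mulr_gt0.
have cw : cabs w = a%:R * e0 ^+ k.+1.
  by rewrite wE cabsM cabs_expi mulr1 cabs_real// ltW.
have wn0 : w != 0.
  apply: contraTneq m0 => w0; rewrite -cw w0 /cabs.
  by rewrite Normc.normc0 ltxx.
have argw : carg w = b + e.
  apply: carg_unique => //; first lra.
  by rewrite cw.
(* Here [2 pi + |d| <= 9], because [pi / 2 < 2] and [|d| < 1]. *)
have t9 : t%:R <= 9 / `|d|.
  apply: (le_trans td); rewrite -{2}(divff (lt0r_neq0 d0)) -mulrDl ler_pM2r ?invr_gt0//.
  have /andP[_] := @pihalf_02 R; lra.
split => //; last 2 first.
- exact: le_trans xd.
- have : e0 ^+ k <= `|d| ^+ k by apply: lerXn2r; rewrite ?nnegrE; lra.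
  by rewrite -/rho; lra.
have lnE : complex.Re z - ln (cabs w) = ln (x / a%:R).
  rewrite -[complex.Re z](@expRK R) -/rho cw -ln_div ?posrE//.
  by congr ln; rewrite /x; field; rewrite !lt0r_neq0.
have xa1 : 1 <= x / a%:R by rewrite ler_pdivlMr//; lra.
have ln0 : 0 <= ln (x / a%:R) by rewrite ln_ge0.
have ln1 : ln (x / a%:R) <= 1 / 39.
  have -> : x / a%:R = 1 + (x / a%:R - 1) by lra.
  rewrite (le_trans (le_ln1Dx _))//; first lra.
  have -> : x / a%:R - 1 = (x - a%:R) / a%:R by field; rewrite lt0r_neq0.
  rewrite ler_pdivrMr//; lra.
apply: (le_trans (cabs_le_ReIm _)).
have -> : complex.Re (z - clog w) = complex.Re z - ln (cabs w) by case: (z).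
have -> : complex.Im (z - clog w) = complex.Im z - (b + e) by rewrite -argw; case: (z).
rewrite lnE ger0_norm//.
(* The capping loss [Im z - b] and the overshoot [e] both lie in [[0, 1 / 20]] and enter with
   opposite signs. Adding [1 / 39] for the modulus stays below [1 / 10]. *)
have : `|complex.Im z - (b + e)| <= 1 / 20 by rewrite ler_norml; lra.
lra.
Qed.

(** * Using the Diophantine condition *)

(* Dirichlet's [q'] may lie below the threshold [Q] where the Diophantine bound
   starts, so it is replaced by [Q * q']. *)
Lemma small_nonzero_multiple (R : realType) (m theta : R) (Q N : nat) :
  0 < m -> (0 < Q)%N -> (0 < N)%N ->
  (forall q : nat, (Q <= q)%N -> forall p : int,
    q%:R `^ (- m) <= `|theta - 2 * pi * p%:~R / q%:R|) ->
  exists q : nat, exists p : int, exists d : R,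
    [/\ q%:R * theta = d + 2 * pi * p%:~R, (q <= Q * N)%N, `|d| <= 8 * Q%:R / N%:R,
        0 < `|d| & `|d|^-1 <= (Q * N)%:R `^ m].
Proof.
move=> m0 Q0 N0 dc.
have [q [p [/andP[q0 qN] qp]]] := dirichlet_approximation (theta / (2 * pi)) N0.
have pi0 := pi_gt0 R.
pose d := (Q * q)%:R * theta - 2 * pi * (Q%:Z * p)%:~R.
have Qq0 : (0 < Q * q)%N by rewrite muln_gt0 Q0.
have Qq1 : 1 <= (Q * q)%:R :> R by rewrite ler1n.
(* Multiplying the Diophantine bound by [Q * q >= 1] only enlarges the distance. *)
have dge : ((Q * q)%:R `^ m)^-1 <= `|d|.
  rewrite -powRN (le_trans (dc _ _ (Q%:Z * p)))//; first by rewrite leq_pmulr.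
  have -> : d = (theta - 2 * pi * (Q%:Z * p)%:~R / (Q * q)%:R) * (Q * q)%:R.
    by rewrite /d; field; rewrite !pnatr_eq0 -!lt0n q0 Q0.
  by rewrite normrM [X in _ <= _ * X]ger0_norm// ler_peMr.
have pw0 : 0 < (Q * q)%:R `^ m :> R by rewrite powR_gt0// (lt_le_trans ltr01).
have d0 : 0 < `|d| by rewrite (lt_le_trans _ dge)// invr_gt0.
exists (Q * q)%N, (Q%:Z * p), d; split => //.
- by rewrite /d; lra.
- by rewrite leq_mul2l qN orbT.
- have -> : d = (2 * pi * Q%:R) * (q%:R * (theta / (2 * pi)) - p%:~R).
    have : 2 * pi != 0 :> R by rewrite lt0r_neq0// mulr_gt0.
    by rewrite /d intrM natrM; move: (2 * pi : R) => c c0; field.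
  rewrite normrM [X in X * _]ger0_norm ?mulr_ge0 ?(ltW pi0)// ler_pM ?mulr_ge0 ?(ltW pi0)//.
  by rewrite ler_wpM2r//; have /andP[_] := @pihalf_02 R; lra.
- rewrite -[leRHS]invrK lef_pV2 ?posrE ?invr_gt0//; last first.
    by rewrite powR_gt0// ltr0n muln_gt0 Q0.
  rewrite (le_trans _ dge)// lef_pV2 ?posrE ?powR_gt0 ?ltr0n ?muln_gt0 ?Q0//.
  by rewrite ge0_ler_powR ?nnegrE ?(ltW m0)// ler_nat leq_mul2l qN orbT.
Qed.

(** * Size estimates for the exponent and the total cost *)

(** Taking logarithms, [k g L / 2 <= 40 + g L^2 / 16], so [k <= 80 / (g L) + L / 8]; the last
    hypothesis bounds the first term by [L / 8]. *)
Lemma exponent_bound (R : realType) (g L s d : R) (k : nat) :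
  0 < L -> 640 <= g * L -> 0 <= d <= (expR (g * L / 2))^-1 ->
  - (g / 16 * L ^+ 2) <= s -> expR s <= 40 * d ^+ k -> 640 <= g * L * L ->
  k%:R <= L / 4.
Proof.
move=> L0 gL /andP[d0 du] sge sle gLL.
have dk : d ^+ k <= expR (- (k%:R * (g * L / 2))).
  rewrite expRN expRM_natl -exprVn.
  by apply: lerXn2r; rewrite ?nnegrE ?invr_ge0 ?expR_ge0.
have e40 : 40 <= expR 40 :> R by have := expR_ge1Dx (40 : R); lra.
have : expR s <= expR (40 - k%:R * (g * L / 2)).
  by rewrite expRD (le_trans sle)// ler_pM// exprn_ge0.
rewrite ler_expR => h.
have gL0 : 0 < g * L by lra.
by rewrite -(ler_pM2l gL0); move: h; lra.
Qed.

(** Expanding [(Z - 1) (W - 1) >= 0] turns sums into products; the three summands contribute 10, 1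
    and 80. In use, [Z] bounds [1 / |d|] and [W] is the power of 2. *)
Lemma cost_bound (R : realFieldType) (q t k a Y Z W : R) :
  0 <= q <= Y -> 0 <= t <= 9 * Z -> 0 <= k <= W -> a <= 80 * Z ->
  1 <= Y -> 1 <= Z -> 1 <= W ->
  q * (t + k) + 1 + a * W <= 91 * (Y * Z * W).
Proof.
move=> /andP[q0 qY] /andP[t0 tZ] /andP[k0 kW] aZ Y1 Z1 W1.
have ZW1 : Z + W <= Z * W + 1 by nra.
have ZW : 1 <= Z * W by rewrite mulr_ege1.
have h1 : q * (t + k) <= Y * (9 * Z + W) by apply: ler_pM => //; lra.
have h2 : a * W <= 80 * Z * W by rewrite ler_wpM2r//; lra.
have h3 : Y * (9 * Z + W) <= Y * (10 * (Z * W)) by rewrite ler_wpM2l//; nra.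
have h4 : Z * W <= Y * (Z * W) by rewrite ler_peMl//; lra.
by rewrite -mulrA; lra.
Qed.

(** * From the Diophantine condition to the net *)

(* The choice of [g] makes [(Q N)^(m + 1) <= Q^(m + 1) n^(1/4)] for
   [N] the integer part of [n^g]. *)
Lemma DPV_from_diophantine (R : realType) (m theta g : R) (Q n : nat) :
  g = (4 * (m + 1))^-1 -> 0 < m -> (0 < Q)%N -> (0 < n)%N ->
  (forall q : nat, (Q <= q)%N -> forall p : int,
    q%:R `^ (- m) <= `|theta - 2 * pi * p%:~R / q%:R|) ->
  1 + 640 / g + 364 * Q%:R `^ (m + 1) + 40 * Q%:R / g <= ln n%:R ->
  forall r : R, 0 < r -> r <= expR (g / 16 * ln n%:R ^+ 2) -> DPV theta n r.
Proof.
move=> gE m0 Q0 n0 dc; move LE : (ln _) => L Lbig r r0 rle z [/andP[rez1 rez2] imz].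
have g0 : 0 < g by rewrite gE invr_gt0 mulr_gt0 ?addr_gt0.
have Q1 : 1 <= Q%:R :> R by rewrite ler1n.
have C0 : 0 <= Q%:R `^ (m + 1) by exact: powR_ge0.
have g640 : 0 <= 640 / g by rewrite divr_ge0 ?ler0n ?(ltW g0).
have gQ : 0 <= 40 * Q%:R / g by rewrite divr_ge0 ?mulr_ge0 ?(ltW g0).
(* All summands of the lower bound on [L] are nonnegative, so each may be used alone: [640 / g]
   controls [k], [40 Q / g] makes [N] large against [Q], and [364 Q^(m + 1)] absorbs the final
   constant. *)
have L1 : 1 <= L by lra.
have L640 : 640 <= g * L.
  rewrite mulrC -ler_pdivrMr//.
  lra.
have LQ : 40 * Q%:R <= g * L by rewrite [g * L]mulrC -ler_pdivrMr//; lra.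
(* This is [n^(g / 2)]; as [N] is about [u^2], the bound [8 Q / N] on [|d|] falls below [1 / u]. *)
pose u := expR (g * L / 2).
have u16 : 16 * Q%:R <= u by have := expR_ge1Dx (g * L / 2); rewrite -/u; lra.
have u20 : 20 < u by have := expR_ge1Dx (g * L / 2); rewrite -/u; lra.
have uu : expR (g * L) = u ^+ 2 by rewrite [g * L]splitr expRD expr2.
pose N := Num.truncn (expR (g * L)).
have /andP[Nle Nge] := truncn_itv (expR_ge0 (g * L)).
rewrite -/N -natr1 in Nle Nge.
have Nu : 8 * Q%:R * u <= N%:R.
  have : 16 * Q%:R * u <= u ^+ 2 by rewrite expr2 ler_pM2r//; lra.
  have : 1 * 20 <= Q%:R * u by apply: ler_pM => //; lra.
  by move: Nge; rewrite uu; lra.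
have N0 : (0 < N)%N.
  by rewrite -(ltr0n R) (lt_le_trans _ Nu)// !mulr_gt0//; lra.
have [q [p [d [qth qQN dle d0 dinv]]]] := small_nonzero_multiple m0 Q0 N0 dc.
have du : `|d| <= u^-1.
  rewrite (le_trans dle)// ler_pdivrMr ?ltr0n// [u^-1 * _]mulrC ler_pdivlMr//; lra.
have d20 : 0 < `|d| < 1 / 20.
  rewrite d0 (le_lt_trans du)// div1r ltf_pV2 ?posrE//; lra.
have [k [t [a [wn0 zw td ad rek]]]] := log_value_approx qth d20 rez2 imz.
have [c [cost cE]] := int_poly_value_construct theta q t k.+1 a.
exists (clog (int_poly_value theta c)); last by rewrite cE.
exists (q * (t + k.+1))%N, c; split => //; last by rewrite cE.
apply: (leq_trans cost); rewrite -(ler_nat R).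
have lnr : ln r <= g / 16 * L ^+ 2.
  by rewrite -(expRK (g / 16 * L ^+ 2)) ler_ln ?posrE ?expR_gt0// -LE.
have kL : k%:R <= L / 4.
  have L0 : 0 < L by lra.
  have d_itv : 0 <= `|d| <= u^-1 by rewrite normr_ge0.
  have rez_ge : - (g / 16 * L ^+ 2) <= complex.Re z by lra.
  apply: (exponent_bound L0 L640 d_itv rez_ge rek).
  by rewrite (le_trans L640)// ler_peMr//; lra.
(* Since [2 <= e], the powers of 2 cost at most [n^(1/4)]. *)
have kW : 2 ^+ k <= expR (L / 4).
  apply: (@le_trans _ _ (expR 1 ^+ k)).
    by apply: lerXn2r; rewrite ?nnegrE ?expR_ge0//; have := expR_ge1Dx (1 : R); lra.
  by rewrite -expRM_natl mulr1 ler_expR.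
pose Y : R := (Q * N)%:R; pose Z := Y `^ m; pose W : R := 2 ^+ k.+1.
have Y1 : 1 <= Y by rewrite ler1n muln_gt0 Q0.
have Z1 : 1 <= Z by rewrite -(powRr0 Y) ler_powR// ltW.
have W1 : 1 <= W by rewrite exprn_ege1//; lra.
have kleW : k.+1%:R <= W by rewrite /W -natrX ler_nat ltnW// ltn_expl.
have YZ : Y * Z <= Q%:R `^ (m + 1) * expR (L / 4).
  have -> : Y * Z = Y `^ (m + 1).
    by rewrite addrC powRD ?powRr1//; apply/implyP => _; rewrite lt0r_neq0//; lra.
  have -> : expR (L / 4) = expR (g * L) `^ (m + 1).
    by rewrite -expRM; congr expR; rewrite gE; field; lra.
  rewrite -powRM ?expR_ge0//; apply: ge0_ler_powR; rewrite ?nnegrE.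
  - lra.
  - lra.
  - by rewrite mulr_ge0 ?expR_ge0.
  - by rewrite /Y natrM ler_wpM2l.
have tZ : t%:R <= 9 * Z by rewrite (le_trans td)// ler_wpM2l.
have aZ : a%:R <= 80 * Z by rewrite (le_trans ad)// ler_wpM2l.
have qY : q%:R <= Y by rewrite ler_nat.
(* The cost is at most a constant times [n^(1/2)]; the other square root absorbs the constant. *)
have nE : n%:R = expR (L / 2) * expR (L / 2) :> R.
  by rewrite -expRD -splitr -LE lnK// posrE ltr0n.
rewrite natrD -natr1 !natrM natrD natrX -/W nE.
have YZW : Y * Z * W <= 2 * Q%:R `^ (m + 1) * expR (L / 2).
  have -> : 2 * Q%:R `^ (m + 1) * expR (L / 2) = (Q%:R `^ (m + 1) * expR (L / 4)) * (2 * expR (L / 4)).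
    have -> : expR (L / 2) = expR (L / 4) * expR (L / 4) by rewrite -expRD; congr expR; lra.
    by ring.
  apply: ler_pM => //; [by rewrite mulr_ge0//; lra|lra|].
  by rewrite /W exprS; lra.
have Lexp : 182 * Q%:R `^ (m + 1) <= expR (L / 2).
  by have := expR_ge1Dx (L / 2); lra.
apply: (@le_trans _ _ (91 * (Y * Z * W))); last first.
  apply: (@le_trans _ _ (182 * Q%:R `^ (m + 1) * expR (L / 2))); first lra.
  by rewrite ler_wpM2r ?expR_ge0.
by apply: cost_bound; rewrite ?ler0n//.
Qed.

Theorem proposition1p5 (R : realType) (m theta : R)
    (m_gt0 : 0 < m) (theta_itv : 0 <= theta <= 2 * pi)
    (theta_dc : diophantine_angle m theta) :
  exists2 c : R, 0 < c &
    \forall n \near \oo,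
      (forall r : R, 0 < r -> r < expR (c * ln n%:R ^+ 2) -> DPV theta n r) /\
      ((expR (c * ln n%:R ^+ 2))%:E <= R_DPV n theta)%E.
Proof.
have [q0 _ dc] := theta_dc.
pose g := (4 * (m + 1))^-1.
have g0 : 0 < g by rewrite invr_gt0 mulr_gt0 ?addr_gt0.
exists (g / 16); first by rewrite divr_gt0.
(* The successor keeps [Q] positive even when the threshold [q0] is 0. *)
pose L0 : R := 1 + 640 / g + 364 * q0.+1%:R `^ (m + 1) + 40 * q0.+1%:R / g.
near=> n.
have nL : expR L0 <= n%:R by near: n; exact: nbhs_infty_ger.
have n0 : 0 < n%:R :> R by rewrite (lt_le_trans (expR_gt0 L0)).
have Ln : L0 <= ln n%:R by rewrite -(expRK L0) ler_ln ?posrE ?expR_gt0.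
(* The endpoint is included, so the exponential itself belongs to the set whose supremum is
   [R_DPV]. *)
have dpv : forall r : R, 0 < r -> r <= expR (g / 16 * ln n%:R ^+ 2) -> DPV theta n r.
  apply: (@DPV_from_diophantine R m theta g q0.+1 n) => //; first by rewrite -(ltr0n R).
  by move=> q qq0; apply: dc; exact: ltnW.
split; first by move=> r r0 /ltW; exact: dpv.
apply: ereal_sup_ubound => /=; exists (expR (g / 16 * ln n%:R ^+ 2)) => //.
by split; [exact: expR_gt0|apply: dpv; rewrite ?expR_gt0].
Unshelve. all: by end_near.
Qed.
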